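(* Let $k$ be an algebraically closed field of characteristic zero. For every integer $n \geqslant 3$, the Cayley degree of the special linear group $\mathrm{SL}_n$ over $k$ satisfies $\mathrm{Cay}(\mathrm{SL}_n) \leqslant n-2$.
   Context: All varieties and algebraic groups are defined over $k$, an algebraically closed field of characteristic zero. Let $G$ be a connected linear algebraic group with Lie algebra $\mathfrak{g}$. The group $G$ acts on itself by conjugation and on $\mathfrak{g}$ by the adjoint action. A generalized Cayley map of $G$ is a dominant rational map $\varphi\colon G \dashrightarrow \mathfrak{g}$ that is $G$-equivariant with respect to these actions. Its degree is $\deg\varphi = [k(G):\varphi^*(k(\mathfrak{g}))]$, which is finite; here $k(X)$ denotes the field of rational functions on an irreducible variety $X$. Every connected linear algebraic group admits a generalized Cayley map. The Cayley degree $\mathrm{Cay}(G)$ is the minimal value of $\deg\varphi$ as $\varphi$ ranges over all generalized Cayley maps of $G$. *)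

(* Defs.v *)
From HB Require Import structures.
From mathcomp Require Import all_boot all_order all_algebra.
From mathcomp Require Import mpoly ring.
From mathcomp Require Import boolp.

Set Implicit Arguments.
Unset Strict Implicit.
Unset Printing Implicit Defensive.

Import GRing.Theory.
Local Open Scope ring_scope.
Local Open Scope quotient_scope.

(* Points of affine N-space are row vectors; the value of p at the point a is
   p.@[a 0], where [a 0] is the coordinate function of the only row of a. *)

Section Zariski.
Variables (k : closedFieldType) (N : nat).
Implicit Types X Y Z : 'rV[k]_N -> Prop.

Definition zariski_closed X : Prop :=
  exists S : {mpoly k[N]} -> Prop,
    forall a, X a <-> (forall p, S p -> p.@[a 0] = 0).

Definition zariski_irreducible X : Prop :=
  (exists a, X a) /\
  forall Y Z, zariski_closed Y -> zariski_closed Z ->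
    (forall a, X a -> Y a \/ Z a) ->
    (forall a, X a -> Y a) \/ (forall a, X a -> Z a).

(* A curve argument for irreducibility: any two points of X lie on a curve
   t |-> C(t)/d(t) in X. *)
Lemma irreducible_of_curves X : (exists a, X a) ->
  (forall a b, X a -> X b ->
     exists (d : {poly k}) (C : 'I_N -> {poly k}),
       [/\ d.[0] = 1, d.[1] = 1,
           forall i, (C i).[0] = a 0 i, forall i, (C i).[1] = b 0 i &
           forall t, d.[t] != 0 -> X (\row_i ((C i).[t] / d.[t]))]) ->
  zariski_irreducible X.
Proof.
move=> X0 XC; split=> // Y Z [SY YP] [SZ ZP] XYZ.
have [|nY] := pselect (forall a, X a -> Y a); first by left.
right=> b Xb; apply/(ZP b) => g Sg.
have [a [Xa Ya]] : exists a, X a /\ ~ Y a.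
  apply: contrapT => h; apply: nY => a Xa.
  by apply: contrapT => nYa; apply: h; exists a.
have [f [Sf fa]] : exists f, SY f /\ f.@[a 0] <> 0.
  apply: contrapT => h; apply: Ya; apply/(YP a) => f Sf.
  by apply: contrapT => fa; apply: h; exists f.
apply: contrapT => gb.
have [d [C [d0 d1 C0 C1 CX]]] := XC a b Xa Xb.
have clear (p : {mpoly k[N]}) : exists (m : nat) (F : {poly k}),
    forall t, d.[t] != 0 ->
      F.[t] = d.[t] ^+ m * p.@[(\row_i ((C i).[t] / d.[t])) 0].
  elim/mpolyind: p => [|c mm p _ _ [m [F FE]]].
    by exists 0%N, 0 => t _; rewrite meval0 horner0 mulr0.
  have [m' [F' FE']] : exists (m : nat) (F : {poly k}), forall t, d.[t] != 0 ->
      F.[t] = d.[t] ^+ m * ('X_[mm]).@[(\row_i ((C i).[t] / d.[t])) 0].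
    exists (\sum_i mm i)%N, (\prod_i C i ^+ mm i) => t dt.
    rewrite mevalX horner_prod expr_sum -big_split /=; apply: eq_bigr => i _.
    by rewrite mxE -exprMn mulrC divfK // horner_exp.
  exists (m' + m)%N, (c%:P * d ^+ m * F' + d ^+ m' * F) => t dt.
  rewrite mevalD mevalZ hornerD !hornerM !horner_exp hornerC FE // FE' //.
  by rewrite exprD; ring.
have [m [F FE]] := clear f; have [m' [G GE]] := clear g.
have dn0 : d != 0.
  apply/eqP => d00; move: d0; rewrite d00 horner0 => /esym/eqP.
  by rewrite oner_eq0.
have Fn0 : F != 0.
  apply/eqP => F0; apply: fa.
  have := FE 0; rewrite d0 expr1n mul1r F0 horner0 oner_neq0 => /(_ isT) ->.
  by apply: meval_eq => i; rewrite mxE C0 divr1.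
have Gn0 : G != 0.
  apply/eqP => G0; apply: gb.
  have := GE 1; rewrite d1 expr1n mul1r G0 horner0 oner_neq0 => /(_ isT) ->.
  by apply: meval_eq => i; rewrite mxE C1 divr1.
have /closed_nonrootP[t] : d * F * G != 0 by rewrite !mulf_neq0.
rewrite /root !hornerM !mulf_eq0 !negb_or => /andP[/andP[dt Ft] Gt].
case: (XYZ _ (CX t dt)) => [/YP/(_ f Sf) e|/ZP/(_ g Sg) e].
  by move: Ft; rewrite FE // e mulr0 eqxx.
by move: Gt; rewrite GE // e mulr0 eqxx.
Qed.

End Zariski.

Record affine_variety (k : closedFieldType) (N : nat) := AffineVariety {
  av_point :> 'rV[k]_N -> Prop;
  av_closed : zariski_closed av_point;
  av_irreducible : zariski_irreducible av_point
}.

Section FunctionField.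
Variables (k : closedFieldType) (N : nat) (X : affine_variety k N).

Definition vanishing : pred {mpoly k[N]} :=
  fun p => `[< forall a, X a -> p.@[a 0] = 0 >].

Fact vanishing_ideal : idealr_closed vanishing.
Proof.
split.
- by apply/asboolP => a _; rewrite meval0.
- have [[a Xa] _] := av_irreducible X.
  by apply/negP => /asboolP/(_ a Xa)/eqP; rewrite meval1 oner_eq0.
- move=> c p q /asboolP pX /asboolP qX; apply/asboolP => a Xa.
  by rewrite mevalD mevalM pX // qX // mulr0 addr0.
Qed.
HB.instance Definition _ :=
  isIdealr.Build {mpoly k[N]} vanishing vanishing_ideal.

Fact vanishing_prime : prime_idealr_closed vanishing.
Proof.
move=> p q /asboolP pqX.
have clV (r : {mpoly k[N]}) : zariski_closed (fun a : 'rV[k]_N => r.@[a 0] = 0).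
  exists (fun s => s = r) => a; split=> [ra s -> //|]; exact.
have [_ /(_ _ _ (clV p) (clV q)) irr] := av_irreducible X.
case: irr => [a /pqX/eqP|pX|qX].
- by rewrite mevalM mulf_eq0 => /orP[]/eqP; [left|right].
- by apply/orP; left; apply/asboolP.
- by apply/orP; right; apply/asboolP.
Qed.
HB.instance Definition _ :=
  isPrimeIdealrClosed.Build {mpoly k[N]} vanishing vanishing_prime.

Definition coord_ring := {ideal_quot (vanishing : prime_idealr {mpoly k[N]})}.
HB.instance Definition _ := GRing.ComNzRing.on coord_ring.

Definition coord_unit : pred coord_ring := fun x => `[< exists y, y * x = 1 >].
Definition coord_inv (x : coord_ring) : coord_ring :=
  if pselect (exists y, y * x = 1) is left e then projT1 (cid e) else x.

Fact coord_mulVx : {in coord_unit, left_inverse 1 coord_inv *%R}.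
Proof.
move=> x /asboolP ex; rewrite /coord_inv; case: pselect => // e.
exact: projT2 (cid e).
Qed.
Fact coord_unitP x y : y * x = 1 -> coord_unit x.
Proof. by move=> e; apply/asboolP; exists y. Qed.
Fact coord_inv_out : {in [predC coord_unit], coord_inv =1 id}.
Proof.
move=> x nx; rewrite /coord_inv; case: pselect => // e.
by case/negP: nx; apply/asboolP.
Qed.
HB.instance Definition _ :=
  GRing.ComNzRing_hasMulInverse.Build coord_ring
    coord_mulVx coord_unitP coord_inv_out.

Fact coord_domain (x y : coord_ring) : x * y = 0 -> (x == 0) || (y == 0).
Proof. exact: Quotient.rquot_IdomainAxiom. Qed.
HB.instance Definition _ :=
  GRing.ComUnitRing_isIntegral.Build coord_ring coord_domain.

Definition function_field := {fraction coord_ring}.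
HB.instance Definition _ := GRing.Field.on function_field.

Definition poly_fun (p : {mpoly k[N]}) : function_field :=
  FracField.tofrac (\pi_coord_ring p : coord_ring).

(* The rational function f is defined at a, with value v there. *)
Definition fun_value (f : function_field) (a : 'rV[k]_N) (v : k) : Prop :=
  exists p q : {mpoly k[N]},
    [/\ q.@[a 0] != 0, f = poly_fun p / poly_fun q & v = p.@[a 0] / q.@[a 0]].

End FunctionField.

Section RationalMap.
Variables (k : closedFieldType) (N M : nat).

Definition map_value (X : affine_variety k N) (phi : 'rV[function_field X]_M)
    (a : 'rV[k]_N) (b : 'rV[k]_M) : Prop :=
  forall i, fun_value (phi 0 i) a (b 0 i).

Record rational_map (X : affine_variety k N) (Y : affine_variety k M) :=
  RationalMap {
    rm_coord :> 'rV[function_field X]_M;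
    rm_into : forall a b, X a -> map_value rm_coord a b -> Y b
  }.

Variables (X : affine_variety k N) (Y : affine_variety k M).
Variable phi : rational_map X Y.

Definition dominant : Prop :=
  forall Z : 'rV[k]_M -> Prop, zariski_closed Z ->
    (forall a b, X a -> map_value phi a b -> Z b) -> forall b, Y b -> Z b.

(* h is the embedding phi^* of k(Y) into k(X), i.e. composition with phi: it
   maps the class of a polynomial P to P(phi).  A field morphism is determined
   by its values on the classes of polynomials. *)
Definition is_comorphism
    (h : {rmorphism function_field Y -> function_field X}) : Prop :=
  forall P : {mpoly k[M]},
    h (poly_fun Y P) = mmap (fun c => poly_fun X c%:MP) (fun i => phi 0 i) P.

End RationalMap.

(* [L : F] = d for a subfield F of L: L has an F-basis with d elements. *)
Definition extension_degree (L : fieldType) (F : L -> Prop) (d : nat) : Prop :=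
  exists e : 'I_d -> L,
    (forall x, exists2 c : 'I_d -> L,
       forall i, F (c i) & x = \sum_i c i * e i) /\
    (forall c : 'I_d -> L, (forall i, F (c i)) ->
       \sum_i c i * e i = 0 -> forall i, c i = 0).

Definition degree (k : closedFieldType) (N M : nat) (X : affine_variety k N)
    (Y : affine_variety k M) (phi : rational_map X Y) (d : nat) : Prop :=
  exists2 h : {rmorphism function_field Y -> function_field X},
    is_comorphism phi h &
    extension_degree (fun f => exists g, f = h g) d.

(* Connected linear algebraic groups.  An n x n matrix A is the point mxvec A
   of affine space.  The group is required to be closed in the space of all
   matrices, not just in GL_n; up to isomorphism this loses nothing, because
   A |-> diag(A, 1/det A) embeds GL_n in GL_(n+1) with such an image.
   For a closed subgroup, connected and irreducible are the same. *)
Record connected_group (k : closedFieldType) (n : nat) := ConnectedGroup {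
  cg_variety :> affine_variety k (n * n);
  cg_one : cg_variety (mxvec 1%:M);
  cg_mul : forall A B : 'M[k]_n, cg_variety (mxvec A) -> cg_variety (mxvec B) ->
    cg_variety (mxvec (A *m B));
  cg_unit : forall A : 'M[k]_n, cg_variety (mxvec A) -> A \in unitmx;
  cg_inv : forall A : 'M[k]_n, cg_variety (mxvec A) ->
    cg_variety (mxvec (invmx A))
}.

Section CayleyMap.
Variables (k : closedFieldType) (n : nat) (G : connected_group k n).

(* The Lie algebra is the tangent space at the identity. *)
Definition tangent_at_one (x : 'rV[k]_(n * n)) : Prop :=
  forall p, p \in vanishing G ->
    \sum_i p^`M(i).@[(mxvec (1%:M : 'M[k]_n)) 0] * x 0 i = 0.

Fact lie_closed : zariski_closed tangent_at_one.
Proof.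
exists (fun q => exists2 p, p \in vanishing G &
  q = \sum_i p^`M(i).@[(mxvec (1%:M : 'M[k]_n)) 0] *: 'X_i) => x.
split=> [Tx q [p pG ->]|h p pG].
  rewrite -[RHS](Tx p pG) raddf_sum; apply: eq_bigr => i _.
  by rewrite /= mevalZ mevalXU.
have := h _ (ex_intro2 _ _ p pG erefl); rewrite raddf_sum => e.
by rewrite -[RHS]e; apply: eq_bigr => i _; rewrite /= mevalZ mevalXU.
Qed.

Fact lie_irreducible : zariski_irreducible tangent_at_one.
Proof.
apply: irreducible_of_curves.
  by exists 0 => p _; apply: big1 => i _; rewrite mxE mulr0.
move=> a b Ta Tb; exists 1, (fun i => (a 0 i)%:P + (b 0 i - a 0 i) *: 'X).
split=> [||i|i|t _ p pG].
- by rewrite hornerC.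
- by rewrite hornerC.
- by rewrite hornerD hornerC hornerZ hornerX ?mulr0 ?addr0.
- by rewrite hornerD hornerC hornerZ hornerX ?mulr1 addrC subrK.
rewrite (eq_bigr (fun i =>
    p^`M(i).@[(mxvec (1%:M : 'M[k]_n)) 0] * a 0 i * (1 - t)
  + p^`M(i).@[(mxvec (1%:M : 'M[k]_n)) 0] * b 0 i * t)) => [|i _].
  by rewrite big_split /= -!mulr_suml Ta // Tb // !mul0r addr0.
rewrite mxE hornerC hornerD hornerC hornerZ hornerX divr1 -!mulrA -mulrDr.
by congr (_ * _); ring.
Qed.

Definition lie_algebra : affine_variety k (n * n) :=
  AffineVariety lie_closed lie_irreducible.

(* Equality of the rational maps x |-> phi (g x g^-1) and x |-> g (phi x) g^-1:
   the values agree wherever both sides are defined. *)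
Definition equivariant (phi : rational_map G lie_algebra) : Prop :=
  forall g x : 'M[k]_n, G (mxvec g) -> G (mxvec x) ->
  forall y z : 'M[k]_n,
    map_value phi (mxvec x) (mxvec y) ->
    map_value phi (mxvec (g *m x *m invmx g)) (mxvec z) ->
    z = g *m y *m invmx g.

Definition generalized_Cayley_map (phi : rational_map G lie_algebra) : Prop :=
  dominant phi /\ equivariant phi.

(* Cay(G) = d: the minimum of the degrees exists and equals d. *)
Definition Cayley_degree (d : nat) : Prop :=
  (exists2 phi, generalized_Cayley_map phi & degree phi d) /\
  (forall phi e, generalized_Cayley_map phi -> degree phi e -> (d <= e)%N).

End CayleyMap.

Section SpecialLinear.
Variables (k : closedFieldType) (n : nat).

Definition SL_point (a : 'rV[k]_(n * n)) : Prop := \det (vec_mx a) = 1.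

Fact SL_closed : zariski_closed SL_point.
Proof.
pose X : 'M[{mpoly k[n * n]}]_n := \matrix_(i, j) 'X_(mxvec_index i j).
exists (fun p => p = \det X - 1) => a.
have detX : (\det X).@[a 0] = \det (vec_mx a).
  rewrite -det_map_mx; congr (\det _).
  by apply/matrixP => i j; rewrite !mxE /= mevalXU.
split=> [aS p ->|/(_ _ erefl)]; rewrite mevalB meval1 detX.
  by rewrite aS subrr.
by move/eqP; rewrite subr_eq0 => /eqP.
Qed.

End SpecialLinear.

Fact SL_irreducible (k : closedFieldType) (n : nat) :
  zariski_irreducible (@SL_point k n).
Proof.
apply: irreducible_of_curves.
  by exists (mxvec 1%:M); rewrite /SL_point mxvecK det1.
move=> a b aS bS; case: n a b aS bS => [|n] a b aS bS.
  exists 1, (fun i => (a 0 i)%:P); split=> [||i|i|t _]; rewrite ?hornerC //.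
    by have : (i < 0)%N by exact: ltn_ord i.
  by rewrite /SL_point det_mx00.
pose P : 'M[{poly k}]_n.+1 :=
  \matrix_(i, j) ((vec_mx a i j)%:P + (vec_mx b i j - vec_mx a i j) *: 'X).
pose D := \det P.
pose Q : 'M[{poly k}]_n.+1 :=
  \matrix_(i, j) ((if i == 0 then 1 else D) * P i j).
have Pt t : map_mx (horner_eval t) P = vec_mx a + t *: (vec_mx b - vec_mx a).
  by apply/matrixP => i j; rewrite !mxE /horner_eval !hornerE mulrC.
have Dt t : D.[t] = \det (vec_mx a + t *: (vec_mx b - vec_mx a)).
  by rewrite -Pt det_map_mx.
have D0 : D.[0] = 1 by rewrite Dt scale0r addr0.
have D1 : D.[1] = 1 by rewrite Dt scale1r addrC subrK.
exists D, (fun i => mxvec Q 0 i); split=> // [i|i|t dt].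
- case/mxvec_indexP: i => i j; rewrite mxvecE !mxE.
  rewrite hornerM hornerD hornerC hornerZ hornerX.
  by case: ifP; rewrite ?hornerC ?D0 mul1r ?mulr0 ?addr0.
- case/mxvec_indexP: i => i j; rewrite mxvecE !mxE.
  rewrite hornerM hornerD hornerC hornerZ hornerX.
  by case: ifP; rewrite ?hornerC ?D1 mul1r ?mulr1 addrC subrK.
rewrite /SL_point.
pose S : 'rV[k]_n.+1 := \row_i (if i == 0 then D.[t]^-1 else 1).
have -> : vec_mx (\row_i ((mxvec Q 0 i).[t] / D.[t])) =
    diag_mx S *m map_mx (horner_eval t) P.
  apply/matrixP => i j; rewrite mul_diag_mx !mxE mxvecE mxE hornerM.
  rewrite /horner_eval !mxE; case: ifP => _.
    by rewrite hornerC mul1r mulrC.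
  by rewrite mul1r mulrAC divff // mul1r.
rewrite det_mulmx det_diag det_map_mx /horner_eval -/D.
rewrite big_ord_recl big1 => [|i _]; last by rewrite mxE.
by rewrite mxE eqxx mulr1 mulVf.
Qed.

Section SpecialLinearGroup.
Variables (k : closedFieldType) (n : nat).

Definition SL_variety : affine_variety k (n * n) :=
  AffineVariety (@SL_closed k n) (@SL_irreducible k n).

Fact SL_one : SL_variety (mxvec 1%:M).
Proof. by rewrite /= /SL_point mxvecK det1. Qed.
Fact SL_mul (A B : 'M[k]_n) : SL_variety (mxvec A) -> SL_variety (mxvec B) ->
  SL_variety (mxvec (A *m B)).
Proof. by rewrite /= /SL_point !mxvecK det_mulmx => -> ->; rewrite mulr1. Qed.
Fact SL_unit (A : 'M[k]_n) : SL_variety (mxvec A) -> A \in unitmx.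
Proof. by rewrite /= /SL_point mxvecK unitmxE => ->; rewrite unitr1. Qed.
Fact SL_inv (A : 'M[k]_n) : SL_variety (mxvec A) ->
  SL_variety (mxvec (invmx A)).
Proof. by rewrite /= /SL_point !mxvecK det_inv => ->; rewrite invr1. Qed.

Definition SL : connected_group k n :=
  ConnectedGroup SL_one SL_mul SL_unit SL_inv.

End SpecialLinearGroup.

Arguments SL : clear implicits.

(* Main.v *)
From HB Require Import structures.
Require Import Defs.
From mathcomp Require Import all_boot all_order all_algebra.
From mathcomp Require Import mpoly ring boolp.

(* Fix z != 1 with z^n = 1.  For X in SL_n put V = (X - 1)(X - z)^-1,
   u = 1 / tr V and W = u V, which has trace 1; the Cayley map is
   X |-> W - 1/n.  Solving for X gives X = (u - W)^-1 (u - z W), so that, chi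
   being the characteristic polynomial of W, det X = 1 means
   chi(u) = chi(u/z).  In chi(x) - chi(x/z) the terms of degree 0 and n cancel,
   hence u is a root of a polynomial of degree n - 2 over k(sl_n), while
   k(SL_n) = k(sl_n)(u). *)

Set Implicit Arguments.
Unset Strict Implicit.
Unset Printing Implicit Defensive.

Import GRing.Theory.
Local Open Scope ring_scope.
Local Open Scope quotient_scope.

(** * Function fields and values of rational functions *)

(** Geometrically, X |-> V identifies SL_n birationally with the hypersurface det(1 - V) = det(1 -
    zV) in the space of matrices, and V |-> W is the projection from the origin to the hyperplane of
    trace 1. The terms of degree i in this equation carry the factor 1 - z^i. Hence its degree is at
    most n - 1, as z^n = 1, and its lowest term is -(1 - z) tr V, so the origin is a simple point. A
    general line through the origin leaves at most n - 2 further intersections. The delicate point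
    is where the map is defined: [fun_value] admits every fraction that represents a function, so
    claims about all points of definition cannot be read off the formula for W. They are deduced
    from identities over k(SL_n) for the generic matrix. Conversely, nonvanishing in k(SL_n) is
    deduced from a single point of SL_n, found over 0 in sl_n. *)

Lemma fractionP (R : idomainType) (f : {fraction R}) :
  exists x y : R, y != 0 /\ f = FracField.tofrac x / FracField.tofrac y.
Proof.
elim/quotW: f => -[[n d] /= dn0]; exists n, d; split=> //.
apply: (canRL (mulfK _)); first by rewrite tofrac_eq0.
unlock FracField.tofrac; rewrite -[LHS]FracField.pi_mul; apply/eqmodP => /=.
rewrite FracField.equivfE /FracField.mulf /=.
by rewrite !numden_Ratio ?mulf_neq0 ?oner_eq0 // !mulr1 mulrC.
Qed.

Section FunctionFieldTheory.
Variables (k : closedFieldType) (N : nat) (X : affine_variety k N).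
Implicit Types (p q : {mpoly k[N]}) (f g : function_field X) (a : 'rV[k]_N).

Fact poly_fun_zmod : zmod_morphism (@poly_fun k N X).
Proof.
by move=> p q; rewrite /poly_fun rmorphB /= -tofracB.
Qed.
Fact poly_fun_monoid : monoid_morphism (@poly_fun k N X).
Proof.
split; rewrite /poly_fun; first by rewrite rmorph1 tofrac1.
by move=> p q; rewrite rmorphM tofracM.
Qed.
HB.instance Definition _ := GRing.isZmodMorphism.Build _ _ _ poly_fun_zmod.
HB.instance Definition _ := GRing.isMonoidMorphism.Build _ _ _ poly_fun_monoid.

Lemma vanishingP p : reflect (forall a, X a -> p.@[a 0] = 0) (p \in vanishing X).
Proof. exact: asboolP. Qed.

Lemma vanishingM p q :
  (p * q \in vanishing X) = (p \in vanishing X) || (q \in vanishing X).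
Proof. exact: prime_idealrM. Qed.

Lemma notin_vanishingM p q :
  p \notin vanishing X -> q \notin vanishing X -> p * q \notin vanishing X.
Proof. by move=> p0 q0; rewrite vanishingM negb_or p0. Qed.

Lemma poly_fun_eq0 p : (poly_fun X p == 0) = (p \in vanishing X).
Proof.
rewrite /poly_fun tofrac_eq0 -[p in RHS]subr0 Quotient.idealrBE.
by congr (_ == _); rewrite (rmorph0 \pi_(coord_ring X)).
Qed.

Lemma function_fieldP f : exists p q,
  q \notin vanishing X /\ f = poly_fun X p / poly_fun X q.
Proof.
have [x [y [yn0 ->]]] := fractionP f.
exists (repr x), (repr y); rewrite -poly_fun_eq0 /poly_fun !reprK tofrac_eq0.
by [].
Qed.

(** Universal property: the condition on the kernel makes [psi] injective on the coordinate ring, so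
    denominators stay invertible. [h] uses chosen numerators and denominators; [hE] shows that the
    choice does not matter. *)
Lemma function_field_lift (K : fieldType) (psi : {rmorphism {mpoly k[N]} -> K}) :
    (forall p, (psi p == 0) = (p \in vanishing X)) ->
  exists h : {rmorphism function_field X -> K},
    forall p, h (poly_fun X p) = psi p.
Proof.
move=> psi0; pose num f := projT1 (cid (function_fieldP f)).
pose den f := projT1 (cid (projT2 (cid (function_fieldP f)))).
have numdenP f : den f \notin vanishing X /\
    f = poly_fun X (num f) / poly_fun X (den f).
  exact: projT2 (cid (projT2 (cid (function_fieldP f)))).
pose h f := psi (num f) / psi (den f).
have hE p q : q \notin vanishing X ->
    h (poly_fun X p / poly_fun X q) = psi p / psi q.
  move=> q0; have [] := numdenP (poly_fun X p / poly_fun X q).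
  rewrite /h; move: (num _) (den _) => p' q' q'0 /eqP.
  rewrite eqr_div ?poly_fun_eq0 // -!rmorphM -subr_eq0 -rmorphB poly_fun_eq0.
  rewrite -psi0 rmorphB subr_eq0 !rmorphM => e.
  by apply/eqP; rewrite eqr_div ?psi0 // eq_sym.
have hB : zmod_morphism h.
  move=> f g /=; case: (numdenP f) => qf0 fE; have [qg0 gE] := numdenP g.
  rewrite {1}fE {1}gE -mulNr -rmorphN addf_div ?poly_fun_eq0 //.
  rewrite -!rmorphM -rmorphD hE ?notin_vanishingM //.
  by rewrite rmorphD !rmorphM rmorphN -addf_div ?psi0 // mulNr.
have V1 : 1 \notin vanishing X by rewrite -poly_fun_eq0 rmorph1 oner_eq0.
have hM : monoid_morphism h.
  split; first by have := hE 1 1 V1; rewrite !rmorph1 !divr1.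
  move=> f g /=; case: (numdenP f) (numdenP g) => qf0 fE [qg0 gE].
  rewrite {1}fE {1}gE mulf_div -!rmorphM hE ?notin_vanishingM //.
  by rewrite !rmorphM -mulf_div.
pose hm := GRing.isMonoidMorphism.Build _ _ h hM.
pose hz := GRing.isZmodMorphism.Build _ _ h hB.
pose H : {rmorphism function_field X -> K} := HB.pack h hm hz.
exists H => p /=.
by have := hE p 1 V1; rewrite !rmorph1 !divr1.
Qed.

Lemma vanishing_dense p q : q \notin vanishing X ->
    (forall a, X a -> q.@[a 0] != 0 -> p.@[a 0] = 0) ->
  p \in vanishing X.
Proof.
move=> q0 pq; have : p * q \in vanishing X.
  apply/vanishingP => a Xa; rewrite mevalM.
  by have [->|/(pq a Xa) ->] := eqVneq q.@[a 0] 0; rewrite ?mulr0 ?mul0r.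
by rewrite vanishingM (negPf q0) orbF.
Qed.

Lemma notin_vanishing p a : X a -> p.@[a 0] != 0 -> p \notin vanishing X.
Proof. by move=> Xa; apply: contraNN => /vanishingP ->. Qed.

(** * Values at a point, for field and matrix operations *)

Section Value.
Variable a : 'rV[k]_N.
Hypothesis Xa : X a.
Implicit Types v w : k.

Lemma fun_value_inj f v w : fun_value f a v -> fun_value f a w -> v = w.
Proof.
move=> [p [q [qa -> ->]]] [p' [q' [q'a /eqP e ->]]].
move: e; rewrite eqr_div ?poly_fun_eq0 ?(notin_vanishing Xa) //.
rewrite -!rmorphM -subr_eq0 -rmorphB poly_fun_eq0 => /vanishingP/(_ a Xa).
rewrite mevalB !mevalM => /eqP; rewrite subr_eq0 => e.
by apply/eqP; rewrite eqr_div.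
Qed.

Lemma fun_value_poly p : fun_value (poly_fun X p) a p.@[a 0].
Proof. by exists p, 1; rewrite meval1 rmorph1 !divr1 oner_neq0. Qed.

Lemma fun_valueD f g v w :
  fun_value f a v -> fun_value g a w -> fun_value (f + g) a (v + w).
Proof.
move=> [p [q [qa -> ->]]] [p' [q' [q'a -> ->]]].
exists (p * q' + p' * q), (q * q'); split; first by rewrite mevalM mulf_neq0.
  by rewrite addf_div ?poly_fun_eq0 ?(notin_vanishing Xa) // rmorphD !rmorphM.
by rewrite addf_div // mevalD !mevalM.
Qed.

Lemma fun_valueM f g v w :
  fun_value f a v -> fun_value g a w -> fun_value (f * g) a (v * w).
Proof.
move=> [p [q [qa -> ->]]] [p' [q' [q'a -> ->]]].
exists (p * p'), (q * q'); split; first by rewrite mevalM mulf_neq0.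
  by rewrite mulf_div !rmorphM.
by rewrite mulf_div !mevalM.
Qed.

Lemma fun_valueV f v : v != 0 -> fun_value f a v -> fun_value f^-1 a v^-1.
Proof.
move=> v0 [p [q [qa -> vE]]]; move: v0; rewrite {}vE => v0.
exists q, p; rewrite !invf_div; split=> //.
by apply: contra_neq v0 => ->; rewrite mul0r.
Qed.

Lemma fun_value_const c : fun_value (poly_fun X c%:MP) a c.
Proof. by rewrite -[c in X in fun_value _ _ X](mevalC (a 0) c); apply: fun_value_poly. Qed.

Lemma fun_value0 : fun_value (0 : function_field X) a 0.
Proof. by have := fun_value_const 0; rewrite !rmorph0. Qed.

Lemma fun_value1 : fun_value (1 : function_field X) a 1.
Proof. by have := fun_value_const 1; rewrite !rmorph1. Qed.

Lemma fun_valueN f v : fun_value f a v -> fun_value (- f) a (- v).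
Proof.
move=> fv; rewrite -mulN1r -[- v]mulN1r; apply: fun_valueM => //.
by have := fun_value_const (-1); rewrite !rmorphN1.
Qed.

Lemma fun_value_sum (I : Type) (r : seq I) (P : pred I)
    (F : I -> function_field X) (V : I -> k) :
    (forall i, P i -> fun_value (F i) a (V i)) ->
  fun_value (\sum_(i <- r | P i) F i) a (\sum_(i <- r | P i) V i).
Proof.
move=> FV; apply: (big_ind2 (fun f v => fun_value f a v)) => //.
  exact: fun_value0.
by move=> f1 v1 f2 v2; apply: fun_valueD.
Qed.

Lemma fun_value_prod (I : Type) (r : seq I) (P : pred I)
    (F : I -> function_field X) (V : I -> k) :
    (forall i, P i -> fun_value (F i) a (V i)) ->
  fun_value (\prod_(i <- r | P i) F i) a (\prod_(i <- r | P i) V i).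
Proof.
move=> FV; apply: (big_ind2 (fun f v => fun_value f a v)) => //.
  exact: fun_value1.
by move=> f1 v1 f2 v2; apply: fun_valueM.
Qed.

Lemma fun_value_sign m f v :
  fun_value f a v -> fun_value ((-1) ^+ m * f) a ((-1) ^+ m * v).
Proof.
move=> fv; rewrite -(signr_odd (function_field X)) -(signr_odd k).
by case: (odd m); rewrite ?mul1r // !expr1 !mulN1r; apply: fun_valueN.
Qed.

Definition mx_value m n (F : 'M[function_field X]_(m, n)) (V : 'M[k]_(m, n)) :=
  forall i j, fun_value (F i j) a (V i j).

Lemma mx_valueM m n l (F : 'M_(m, n)) (G : 'M_(n, l)) V W :
  mx_value F V -> mx_value G W -> mx_value (F *m G) (V *m W).
Proof.
by move=> FV GW i j; rewrite !mxE; apply: fun_value_sum => s _; apply: fun_valueM.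
Qed.

Lemma mx_valueD m n (F G : 'M_(m, n)) V W :
  mx_value F V -> mx_value G W -> mx_value (F + G) (V + W).
Proof. by move=> FV GW i j; rewrite !mxE; apply: fun_valueD. Qed.

Lemma mx_valueN m n (F : 'M_(m, n)) V : mx_value F V -> mx_value (- F) (- V).
Proof. by move=> FV i j; rewrite !mxE; apply: fun_valueN. Qed.

Lemma mx_valueZ m n f v (F : 'M_(m, n)) V :
  fun_value f a v -> mx_value F V -> mx_value (f *: F) (v *: V).
Proof. by move=> fv FV i j; rewrite !mxE; apply: fun_valueM. Qed.

Lemma mx_value_scalar n f v : fun_value f a v -> mx_value f%:M (v%:M : 'M_n).
Proof.
move=> fv i j; rewrite !mxE; case: (i == j) => //.
exact: fun_value0.
Qed.

Lemma fun_value_det n (F : 'M_n) V : mx_value F V -> fun_value (\det F) a (\det V).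
Proof.
move=> FV; apply: fun_value_sum => s _; apply: fun_value_sign.
by apply: fun_value_prod => i _.
Qed.

Lemma fun_value_trace n (F : 'M_n) V : mx_value F V -> fun_value (\tr F) a (\tr V).
Proof. by move=> FV; apply: fun_value_sum. Qed.

Lemma mx_value_adj n (F : 'M_n) V : mx_value F V -> mx_value (\adj F) (\adj V).
Proof.
move=> FV i j; rewrite !mxE /cofactor; apply: fun_value_sign.
by apply: fun_value_det => r c; rewrite !mxE.
Qed.

Lemma fun_value_neq0 f v : v != 0 -> fun_value f a v -> f != 0.
Proof.
move=> v0 fv; apply: contra_neq v0 => f0.
by apply: (fun_value_inj fv); rewrite f0; apply: fun_value0.
Qed.

Lemma mx_value_inv n (F : 'M_n) V : V \in unitmx ->
  mx_value F V -> mx_value (invmx F) (invmx V).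
Proof.
move=> uV FV; have dV : \det V != 0 by rewrite -unitfE -unitmxE.
have uF : F \in unitmx.
  by rewrite unitmxE unitfE (fun_value_neq0 dV) //; apply: fun_value_det.
rewrite /invmx uV uF; apply: mx_valueZ; last exact: mx_value_adj.
by apply: fun_valueV => //; apply: fun_value_det.
Qed.

End Value.

Lemma fun_value_dense f q : q \notin vanishing X ->
    (forall a, X a -> q.@[a 0] != 0 -> fun_value f a 0) ->
  f = 0.
Proof.
have [p [p' [p'0 ->]]] := function_fieldP f => q0 fq; apply/eqP.
rewrite mulf_eq0 invr_eq0 !poly_fun_eq0 (negPf p'0) orbF.
apply: (@vanishing_dense _ (p' * q)); first exact: notin_vanishingM.
move=> a Xa; rewrite mevalM mulf_eq0 negb_or => /andP[p'a qa].
have fv : fun_value (poly_fun X p / poly_fun X p') a (p.@[a 0] / p'.@[a 0]).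
  by exists p, p'.
have /eqP := fun_value_inj Xa fv (fq a Xa qa).
by rewrite mulf_eq0 invr_eq0 (negPf p'a) orbF => /eqP.
Qed.

End FunctionFieldTheory.

(** * Comorphisms and the degree of a generating element *)

Section Comorphism.
Variables (k : closedFieldType) (N M : nat).
Variables (X : affine_variety k N) (Y : affine_variety k M).

Definition subst_fun (phi : 'rV[function_field X]_M) :
    {mpoly k[M]} -> function_field X :=
  mmap (poly_fun X \o @mpolyC N k) (phi 0).

Lemma fun_value_subst (phi : 'rV[function_field X]_M) a b P :
  X a -> map_value phi a b -> fun_value (subst_fun phi P) a P.@[b 0].
Proof.
move=> Xa phiab; apply: (fun_value_sum Xa) => m _; apply: fun_valueM.
  exact: fun_value_const.
apply: fun_value_prod => i _; elim: (m i) => [|e IH].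
  by rewrite !expr0; apply: fun_value1.
by rewrite !exprS; apply: fun_valueM.
Qed.

Lemma map_value_dense (phi : 'rV[function_field X]_M) : exists2 q,
  q \notin vanishing X &
  forall a : 'rV_N, q.@[a 0] != 0 -> exists b, map_value phi a b.
Proof.
pose p i := projT1 (cid (function_fieldP (phi 0 i))).
pose q i := projT1 (cid (projT2 (cid (function_fieldP (phi 0 i))))).
have pqP i : q i \notin vanishing X /\ phi 0 i = poly_fun X (p i) / poly_fun X (q i).
  exact: projT2 (cid (projT2 (cid (function_fieldP (phi 0 i))))).
exists (\prod_i q i).
  rewrite -poly_fun_eq0 rmorph_prod; apply/prodf_neq0 => i _.
  by rewrite poly_fun_eq0; case: (pqP i).
move=> a; rewrite rmorph_prod => /prodf_neq0 qa.
exists (\row_i ((p i).@[a 0] / (q i).@[a 0])) => i.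
by exists (p i), (q i); split; rewrite ?mxE ?qa //; case: (pqP i).
Qed.

(** The kernel of P |-> P(phi) is the vanishing ideal of [Y]: dominance gives one inclusion,
    [rm_into] on the dense set where phi is defined gives the other. *)
Lemma dominant_comorphism (phi : rational_map X Y) : dominant phi ->
  exists h : {rmorphism function_field Y -> function_field X},
    is_comorphism phi h.
Proof.
move=> dom; apply: (@function_field_lift _ _ Y _ (subst_fun phi)) => P.
rewrite -[X in X == 0]/(subst_fun phi P).
apply/eqP/vanishingP => P0.
  apply: (dom (fun b => P.@[b 0] = 0)).
    by exists (fun p => p = P) => a; split=> [e p ->|/(_ P erefl)].
  move=> a b Xa /(fun_value_subst P Xa); rewrite P0 => Pv.
  by apply: (fun_value_inj Xa Pv); apply: fun_value0.
have [q q0 qP] := map_value_dense phi.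
apply: (fun_value_dense q0) => a Xa /qP[b phiab].
rewrite -(P0 b (rm_into Xa phiab)); exact: fun_value_subst.
Qed.

End Comorphism.

(** * Field extensions generated by one algebraic element *)

Section AlgebraicGenerator.
Variables (L K : fieldType) (h : {rmorphism L -> K}) (u : K).

Let ev (r : {poly L}) : K := (map_poly h r).[u].

Let evD r s : ev (r + s) = ev r + ev s.
Proof. by rewrite /ev rmorphD hornerD. Qed.
Let evB r s : ev (r - s) = ev r - ev s.
Proof. by rewrite /ev rmorphB hornerD hornerN. Qed.
Let evM r s : ev (r * s) = ev r * ev s.
Proof. by rewrite /ev rmorphM hornerM. Qed.
Let evC c : ev c%:P = h c.
Proof. by rewrite /ev map_polyC hornerC. Qed.
Let evX : ev 'X = u.
Proof. by rewrite /ev map_polyX hornerX. Qed.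

(** The last hypothesis says that u generates K as a field over the image of L. Let [q] be a nonzero
    polynomial of least size killing u. The values of polynomials at u already form a field, and the
    powers of u below deg q are a basis. Least size does the work of irreducibility. *)
Lemma generator_degree (p : {poly L}) :
    p != 0 -> (map_poly h p).[u] = 0 ->
    (forall S : divringClosed K, (forall c, h c \in S) -> u \in S ->
       forall x, x \in S) ->
  exists2 d, (d < size p)%N & extension_degree (fun f => exists g, f = h g) d.
Proof.
move=> p0 pu gen.
have [q [q0 qu qmin]] : exists q : {poly L}, [/\ q != 0, ev q = 0 &
    forall r, r != 0 -> ev r = 0 -> (size q <= size r)%N].
  pose A s := `[< exists q : {poly L}, [/\ q != 0, ev q = 0 & size q = s] >].
  have exA : exists s, A s by exists (size p); apply/asboolP; exists p.
  case: (ex_minnP exA) => s /asboolP[q [q0 qu qs]] smin.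
  exists q; split=> // r r0 ru; rewrite qs; apply: smin.
  by apply/asboolP; exists r.
have evmod r : ev r = ev (r %% q).
  by rewrite {1}(divp_eq r q) evD evM qu mulr0 add0r.
pose S : {pred K} := fun x => `[< exists r, x = ev r >].
have S1 : divring_closed S.
  split=> [|x y /asboolP[r ->] /asboolP[s ->]|x y /asboolP[r ->] /asboolP[s ->]].
  - by apply/asboolP; exists 1; rewrite evC rmorph1.
  - by apply/asboolP; exists (r - s).
  (* Closure under division: the convention [0^-1 = 0] settles the first case, a Bezout relation
     between [s] and [q] the coprime one. *)
  have [s0|s0] := eqVneq (ev s) 0.
    by apply/asboolP; exists 0; rewrite s0 invr0 mulr0 evC rmorph0.
  have [cop|ncop] := boolP (coprimep s q).
    have [[v w] /= e] := Bezout_eq1_coprimepP _ _ cop.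
    apply/asboolP; exists (r * v); rewrite evM; congr (_ * _).
    apply: (mulIf s0); rewrite mulVf // -evM.
    have -> : v * s = 1 - w * q by rewrite -e addrK.
    by rewrite evB evM qu mulr0 subr0 evC rmorph1.
  (* A nonconstant g = gcd(s, q) is impossible. Write q = t' g: minimality of q excludes t'(u) = 0,
     while g(u) = 0 would give s(u) = 0. *)
  have g0 : gcdp s q != 0 by rewrite gcdp_eq0 negb_and q0 orbT.
  have [t sE] := dvdpP _ _ (dvdp_gcdl s q).
  have [t' qE] := dvdpP _ _ (dvdp_gcdr s q).
  have t'0 : t' != 0.
    by apply: contraNneq q0 => t'0; rewrite qE t'0 mul0r.
  have : ev t' * ev (gcdp s q) = 0 by rewrite -evM -qE.
  move/eqP; rewrite mulf_eq0 => /orP[/eqP/(qmin _ t'0)|/eqP gu].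
    rewrite {1}qE size_mul // -subn1 leq_subLR addnC leq_add2r => g1.
    by move: ncop; rewrite /coprimep eqn_leq g1 size_poly_gt0 g0.
  by move: s0; rewrite sE evM gu mulr0 eqxx.
pose DS : divringClosed K := HB.pack S (GRing.isDivringClosed.Build K S S1).
have evS (x : K) : exists2 r : {poly L}, (size r < size q)%N & x = ev r.
  have /asboolP[r ->] : x \in DS.
    apply: gen => [c|]; apply/asboolP; first by exists c%:P; rewrite evC.
    by exists 'X.
  by exists (r %% q); [rewrite ltn_modp | apply: evmod].
have sq : (size q).-1.+1 = size q by rewrite prednK // size_poly_gt0.
exists (size q).-1; first by rewrite sq; apply: qmin.
have evE (c : 'I_(size q).-1 -> L) :
    ev (\sum_i c i *: 'X^i) = \sum_i h (c i) * u ^+ i.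
  rewrite /ev raddf_sum horner_sum; apply: eq_bigr => i _ /=.
  by rewrite map_polyZ map_polyXn hornerZ hornerXn.
exists (fun i => u ^+ i); split=> [x|c Fc c0 i].
  have [r rq ->] := evS x; exists (fun i => h r`_i); first by move=> i; exists r`_i.
  rewrite -evE -(poly_def _ (fun i => r`_i)); congr ev.
  apply/polyP => j; rewrite coef_poly; case: ltnP => // jq.
  by apply/nth_default/(leq_trans _ jq); rewrite -ltnS sq.
pose c' i := projT1 (cid (Fc i)).
have c'E j : c j = h (c' j) by exact: projT2 (cid (Fc j)).
(* A linear relation among the powers of u, read as a polynomial of smaller size than [q]; [insub]
   extends its coefficients from ordinals to all indices. *)
pose cc := \poly_(j < (size q).-1) (if insub j is Some j' then c' j' else 0).
have ccE : cc = \sum_j c' j *: 'X^j.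
  by rewrite /cc poly_def; apply: eq_bigr => j _; rewrite valK.
have cc0 : cc = 0.
  apply/eqP; apply: contraT => cc0.
  have := qmin _ cc0; rewrite ccE evE => /(_ _)/leq_trans; rewrite -ccE.
  move=> /(_ _ _ (size_poly _ _)); rewrite -ltnS sq ltnn; apply.
  by rewrite -[RHS]c0; apply: eq_bigr => j _; rewrite c'E.
have := coef_poly (size q).-1 (fun j => if insub j is Some j' then c' j' else 0) i.
by rewrite -/cc cc0 coef0 ltn_ord valK c'E => <-; rewrite rmorph0.
Qed.
End AlgebraicGenerator.

(** * The Cayley transform of matrices *)

(* (chi(x) - chi(x/z)) / x, where chi is the characteristic polynomial of W and
   z^n = 1. *)
Definition twist_poly (F : fieldType) n (W : 'M[F]_n) (z : F) : {poly F} :=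
  \poly_(i < n.-1) ((char_poly W)`_i.+1 * (1 - z ^- i.+1)).

Lemma horner_twist_poly (F : fieldType) n (W : 'M[F]_n) (z x : F) :
    (0 < n)%N -> z ^+ n = 1 ->
  x * (twist_poly W z).[x] = (char_poly W).[x] - (char_poly W).[z^-1 * x].
Proof.
case: n W => // m W _ zn.
rewrite horner_poly !horner_coef size_char_poly -sumrB big_ord_recl.
rewrite big_ord_recr /= /bump /= !expr0 subrr add0r.
rewrite add1n exprMn exprVn zn invr1 mul1r subrr addr0.
rewrite mulr_sumr; apply: eq_bigr => i _; rewrite add1n exprMn exprVn [x ^+ i.+1]exprS.
by move: (z ^- _) => y; ring.
Qed.

Section CayleyMatrix.
Variables (F : fieldType) (n : nat).
Implicit Types (A W : 'M[F]_n) (z x u : F).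

Lemma horner_char_poly W x : (char_poly W).[x] = \det (x%:M - W).
Proof.
rewrite /char_poly -[_.[x]]/(horner_eval x _) -det_map_mx; congr (\det _).
apply/matrixP => i j; rewrite !mxE /= /horner_eval hornerD hornerN hornerC.
by case: (i == j); rewrite ?hornerX ?horner0.
Qed.

Lemma det_sub_scale W z x : z != 0 -> z ^+ n = 1 ->
  \det (x%:M - z *: W) = (char_poly W).[z^-1 * x].
Proof.
move=> z0 zn; rewrite horner_char_poly.
have -> : x%:M - z *: W = z *: ((z^-1 * x)%:M - W).
  by rewrite scalerBr scale_scalar_mx mulrA divff // mul1r.
by rewrite detZ zn mul1r.
Qed.

(** Total by convention: [invmx] fixes singular matrices and [0^-1 = 0], so the lemmas carry the
    invertibility hypotheses. The field is arbitrary because the formula serves both points over k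
    and the generic matrix over k(SL_n). *)
Definition cayley_quot z A := (A - 1%:M) *m invmx (A - z%:M).
Definition cayley_mx z A := (\tr (cayley_quot z A))^-1 *: cayley_quot z A.

(** Everything follows from (u - W)(A - z) = u(1 - z), a nonzero scalar. *)
Lemma cayley_mxK z A (u := (\tr (cayley_quot z A))^-1) (W := cayley_mx z A) :
    z != 1 -> A - z%:M \in unitmx -> \tr (cayley_quot z A) != 0 ->
  [/\ \tr W = 1, u%:M - W \in unitmx &
      A = invmx (u%:M - W) *m (u%:M - z *: W)].
Proof.
move=> z1 uB t0; have u0 : u != 0 by rewrite invr_eq0.
have WB : W *m (A - z%:M) = u *: (A - 1%:M).
  by rewrite -scalemxAl mulmxKV.
have uWE : (u%:M - W) *m (A - z%:M) = (u * (1 - z))%:M.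
  rewrite mulmxBl WB mul_scalar_mx -scalerBr -scale_scalar_mx; congr (_ *: _).
  by rewrite [(1 - z)%:M]raddfB /= opprB [LHS]addrC addrA subrK.
have uW : u%:M - W \in unitmx.
  have : (u%:M - W) *m (A - z%:M) \in unitmx.
    rewrite uWE unitmxE det_scalar unitfE expf_neq0 // mulf_neq0 //.
    by rewrite subr_eq0 eq_sym.
  by rewrite unitmx_mul => /andP[].
split=> //; first by rewrite linearZ /= mulVf.
rewrite -[LHS](mulKmx uW); congr (_ *m _).
move: uWE; rewrite mulmxBr mul_mx_scalar => /eqP; rewrite subr_eq => /eqP ->.
rewrite scalerBr scale_scalar_mx mulrBr mulr1 [(u - _)%:M]raddfB /= addrA.
by rewrite [z * u]mulrC subrK.
Qed.

Lemma cayley_mx_root z A (W := cayley_mx z A) :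
    z != 1 -> z != 0 -> z ^+ n = 1 -> (0 < n)%N -> \det A = 1 ->
    A - z%:M \in unitmx -> \tr (cayley_quot z A) != 0 ->
  exists u, (twist_poly W z).[u] = 0 /\
    A = invmx (u%:M - W) *m (u%:M - z *: W).
Proof.
move=> z1 z0 zn n0 dA uB t0; have [_] := cayley_mxK z1 uB t0.
rewrite -/W; set u := _^-1 => uW AE; exists u; split=> //.
have u0 : u != 0 by rewrite /u invr_eq0.
apply: (mulfI u0); rewrite mulr0 horner_twist_poly // -det_sub_scale //.
have <- : (u%:M - W) *m A = u%:M - z *: W by rewrite [in LHS]AE mulKVmx.
by rewrite det_mulmx dA mulr1 horner_char_poly subrr.
Qed.

(** For A = (u - W)^-1 (u - zW) one finds A - z = (1 - z)u (u - W)^-1 and A - 1 = (1 - z)(u - W)^-1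
    W. Hence the quotient is W/u, and tr W = 1 recovers u from its trace. The root condition chi(u)
    = chi(u/z) gives det A = 1. *)
Lemma cayley_mx_inv z W u : z != 1 -> z != 0 -> u != 0 -> z ^+ n = 1 ->
    (0 < n)%N -> \tr W = 1 -> root (twist_poly W z) u ->
    u%:M - W \in unitmx ->
  exists A, [/\ \det A = 1, A - z%:M \in unitmx,
    \tr (cayley_quot z A) != 0 & cayley_mx z A = W].
Proof.
move=> z1 z0 u0 zn n0 trW /rootP qu uW.
exists (invmx (u%:M - W) *m (u%:M - z *: W)); set A := _ *m _.
have z1' : 1 - z != 0 by rewrite subr_eq0 eq_sym.
have BE : A - z%:M = ((1 - z) * u) *: invmx (u%:M - W).
  rewrite -[z%:M](mulKmx uW) -mulmxBr mul_mx_scalar.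
  have -> : u%:M - z *: W - z *: (u%:M - W) = ((1 - z) * u)%:M.
    rewrite scalerBr opprB addrA subrK scale_scalar_mx -raddfB /=.
    by rewrite mulrBl mul1r.
  by rewrite mul_mx_scalar.
have uB : A - z%:M \in unitmx.
  by rewrite BE unitmxZ ?unitfE ?mulf_neq0 // unitmx_inv.
have A1E : A - 1%:M = (1 - z) *: (invmx (u%:M - W) *m W).
  rewrite -[1%:M](mulVmx uW) -mulmxBr.
  have -> : u%:M - z *: W - (u%:M - W) = (1 - z) *: W.
    by rewrite opprB [LHS]addrC addrA subrK scalerBl scale1r.
  by rewrite -scalemxAr.
have WC : invmx (u%:M - W) *m W = W *m invmx (u%:M - W).
  rewrite -[LHS](mulmxK uW); congr (_ *m _).
  have -> : invmx (u%:M - W) *m W *m (u%:M - W)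
      = invmx (u%:M - W) *m ((u%:M - W) *m W).
    by rewrite -mulmxA mulmxBr mulmxBl mul_mx_scalar mul_scalar_mx.
  by rewrite mulKmx.
have VE : cayley_quot z A = u^-1 *: W.
  rewrite /cayley_quot A1E WC BE invmxZ -?BE // invmxK.
  rewrite -scalemxAl -scalemxAr scalerA mulmxKV // invfM mulrA divff //.
  by rewrite mul1r.
have tV : \tr (cayley_quot z A) = u^-1 by rewrite VE linearZ /= trW mulr1.
split=> //; first last.
- by rewrite /cayley_mx tV VE invrK scalerA divff // scale1r.
- by rewrite tV invr_eq0.
rewrite det_mulmx det_inv det_sub_scale // -horner_char_poly.
have := horner_twist_poly W u n0 zn; rewrite qu mulr0 => /esym/eqP.
rewrite subr_eq0 => /eqP <-; rewrite mulVf // horner_char_poly.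
by rewrite -unitfE -unitmxE.
Qed.

End CayleyMatrix.

(** This coefficient is -tr W (1 - z^-(n+1)), and z^-(n+1) = z. The normalization tr W = 1 thus
    fixes the degree of the twist polynomial at the matrix size minus 2. *)
Lemma twist_poly_neq0 (F : fieldType) n (W : 'M[F]_n.+2) z :
    z != 1 -> z ^+ n.+2 = 1 -> \tr W = 1 -> (twist_poly W z)`_n != 0.
Proof.
move=> z1 zn trW; rewrite coef_poly ltnSn mulf_neq0 //.
  by rewrite -[n.+1]/(n.+2.-1) char_poly_trace // trW oppr_eq0 oner_eq0.
rewrite subr_eq0 eq_sym; apply: contra_neq z1 => /(congr1 GRing.inv) zn1.
by rewrite -zn exprS; move: zn1; rewrite invrK invr1 => ->; rewrite mulr1.
Qed.

Lemma mul_horner_mx (F : fieldType) n (W : 'M[F]_n.+1) (v : 'rV_n.+1) a p :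
  v *m W = a *: v -> v *m horner_mx W p = p.[a] *: v.
Proof.
move=> vW; elim/poly_ind: p => [|p c IH].
  by rewrite rmorph0 mulmx0 horner0 scale0r.
rewrite rmorphD rmorphM /= horner_mx_X horner_mx_C mulmxDr mulmxA IH.
by rewrite -scalemxAl vW mul_mx_scalar scalerA -scalerDl hornerMXaddC.
Qed.

(** The determinant hypothesis is a resultant condition: no eigenvalue w of W has w/z as an
    eigenvalue too. If u - W were singular, chi(u) = 0 and the root condition would make u and u/z
    both eigenvalues; a left eigenvector v for u is then killed by chi(z^-1 W). *)
Lemma twist_poly_root (F : closedFieldType) n (W : 'M[F]_n.+3) z :
    z != 1 -> z ^+ n.+3 = 1 -> \tr W = 1 -> (char_poly W)`_1 != 0 ->
    \det (horner_mx (z^-1 *: W) (char_poly W)) != 0 ->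
  exists u, [/\ u != 0, root (twist_poly W z) u & u%:M - W \in unitmx].
Proof.
move=> z1 zn trW c1 dW; set q := twist_poly W z.
have z0 : z != 0.
  by apply: contra_eq_neq zn => ->; rewrite expr0n eq_sym oner_eq0.
have qn : q`_n.+1 != 0 by apply: twist_poly_neq0.
(* The nonzero coefficient [qn] has index at least 1 because the matrix size is at least 3, so [q]
   is not constant. *)
have /closed_rootP[u qu] : size q != 1%N.
  by apply: contraNneq qn => sq; rewrite nth_default // sq.
exists u; split=> //.
  apply: contraTneq qu => ->; rewrite /root horner_coef0 coef_poly /=.
  rewrite mulf_neq0 // expr1 subr_eq0 eq_sym; apply: contra_neq z1.
  by move/(congr1 GRing.inv); rewrite invrK invr1.
apply: contraT; rewrite unitmxE unitfE negbK -horner_char_poly => chu.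
have /eigenvalueP[v vW v0] : eigenvalue W u by rewrite eigenvalue_root_char.
have chzu : (char_poly W).[z^-1 * u] = 0.
  have := horner_twist_poly W u isT zn.
  by rewrite (rootP qu) mulr0 (eqP chu) sub0r => /esym/eqP; rewrite oppr_eq0 => /eqP.
have vzW : v *m (z^-1 *: W) = (z^-1 * u) *: v by rewrite -scalemxAr vW scalerA.
have := mul_horner_mx (char_poly W) vzW; rewrite chzu scale0r => v0'.
rewrite -unitfE -unitmxE in dW.
by rewrite -(mulmxK dW v) v0' mul0mx eqxx in v0.
Qed.

(** * The Lie algebra of SL *)

Section Derivative.
Variables (k : closedFieldType) (N : nat).
Implicit Types (p q : {mpoly k[N]}) (a x : 'rV[k]_N).

Lemma horner_all_eq0 (r : {poly k}) : (forall t, r.[t] = 0) -> r = 0.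
Proof.
move=> r0; apply/eqP; apply: contraT => /closed_nonrootP[t].
by rewrite /root r0 eqxx.
Qed.

Definition line_poly a x p : {poly k} :=
  mmap polyC (fun i => (a 0 i)%:P + x 0 i *: 'X) p.

Lemma horner_line_poly a x p t : (line_poly a x p).[t] = p.@[(a + t *: x) 0].
Proof.
rewrite /line_poly /mmap horner_sum; apply: eq_bigr => m _.
rewrite hornerM hornerC /mmap1 horner_prod; congr (_ * _).
apply: eq_bigr => i _; rewrite horner_exp hornerD hornerC hornerZ hornerX.
by rewrite !mxE [t * _]mulrC.
Qed.

Definition directional a x p := \sum_i p^`M(i).@[a 0] * x 0 i.

(** Turns the formal partial derivatives of [tangent_at_one] into a one-variable derivative along a
    line. Both sides are additive and obey the Leibniz rule at [a], so constants and variables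
    suffice. *)
Lemma deriv_line_poly a x p : (line_poly a x p)^`().[0] = directional a x p.
Proof.
have ev q : (line_poly a x q).[0] = q.@[a 0].
  by rewrite horner_line_poly scale0r addr0.
pose D q := (line_poly a x q)^`().[0] = directional a x q.
have DM q r : D q -> D r -> D (q * r).
  move=> Dq Dr; rewrite /D /line_poly rmorphM derivM hornerD !hornerM.
  rewrite -!/(line_poly _ _ _) Dq Dr !ev /directional.
  rewrite mulr_suml mulr_sumr -big_split; apply: eq_bigr => i _ /=.
  by rewrite mderivM mevalD !mevalM; ring.
have DC c : D c%:MP.
  rewrite /D /line_poly mmapC derivC horner0 /directional big1 // => i _.
  by rewrite mderivC meval0 mul0r.
have DX i : D 'X_i.
  rewrite /D /line_poly mmapX mmap1U derivD derivC add0r derivZ derivX.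
  rewrite hornerZ hornerC mulr1 /directional (bigD1 i) //= big1 => [|j ji].
    by rewrite mderivX mnm1E eqxx scale1r -{1}[U_(i)%MM]add0m addmK mpolyX0 meval1 mul1r addr0.
  by rewrite mderivX mnm1E eq_sym (negPf ji) scale0r meval0 mul0r.
have DXm m : D 'X_[m].
  rewrite mpolyXE_id; apply: (big_ind D); [exact: DC 1|exact: DM|move=> i _].
  by elim: (m i) => [|e IH]; [apply: DC 1 | rewrite exprS; apply: DM].
elim/mpolyind: p => [|c m p _ _ IH].
  by rewrite -mpolyC0; apply: DC.
rewrite -mul_mpolyC; have DcX := DM _ _ (DC c) (DXm m).
rewrite /line_poly rmorphD derivD hornerD /= -!/(line_poly _ _ _) IH DcX.
rewrite /directional -big_split; apply: eq_bigr => i _ /=.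
by rewrite mderivD mevalD mulrDl.
Qed.

Lemma directional_linear a p c x y :
  directional a (c *: x + y) p = c * directional a x p + directional a y p.
Proof.
rewrite /directional mulr_sumr -big_split; apply: eq_bigr => i _ /=.
by rewrite !mxE; ring.
Qed.

End Derivative.

(** Supplies whole lines through 1 inside SL_n, hence tangent directions at 1. *)
Lemma det_add_square0 (k : closedFieldType) n (A : 'M[k]_n) t :
  A *m A = 0 -> \det (1%:M + t *: A) = 1.
Proof.
move=> A2; pose P c : 'M[{poly k}]_n := 1%:M + (c *: 'X) *: map_mx polyC A.
(* (1 + tA)(1 - tA) = 1, so det(1 + tA) is a unit of k[t]. *)
have PP : P 1 *m P (-1) = 1%:M.
  rewrite /P mulmxDl mul1mx mulmxDr mulmx1 -scalemxAl -scalemxAr -map_mxM A2.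
  by rewrite map_mx0 !scaler0 addr0 scale1r scaleN1r scaleNr addrNK.
have Pt s : (\det (P 1)).[s] = \det (1%:M + s *: A).
  rewrite -[_.[s]]/(horner_eval s _) -det_map_mx; congr (\det _).
  apply/matrixP => i j; rewrite !mxE /= /horner_eval !hornerE.
  by rewrite hornerMn hornerC.
have : \det (P 1) \is a GRing.unit.
  apply/unitrP; exists (\det (P (-1))); rewrite [X in X = _ /\ _]mulrC.
  by rewrite -det_mulmx PP det1.
rewrite poly_unitE => /andP[/size_poly1P[c _ PE] _].
by have := Pt 0; rewrite scale0r addr0 det1 -Pt PE !hornerC.
Qed.

(** Square-zero matrices span the matrices of trace 0: off-diagonal matrix units have square zero,
    and each e_ii - e_00 is a square-zero matrix up to such units. *)
Lemma trace_form (k : fieldType) n (f : {scalar 'M[k]_n.+1}) :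
    (forall A, A *m A = 0 -> f A = 0) ->
  forall A, f A = \tr A * f (delta_mx 0 0).
Proof.
move=> f0 A.
have fE i j : i != j -> f (delta_mx i j) = 0.
  by move=> ij; apply: f0; rewrite mul_delta_mx_0 // eq_sym.
have fD i : f (delta_mx i i) = f (delta_mx 0 0).
  have [->|i0] := eqVneq i 0; first by [].
  (* P - Q = e_ii - e_00 + e_0i - e_i0, whose square is PP - PQ - QP + QQ = P - Q - P + Q = 0. *)
  pose P : 'M[k]_n.+1 := delta_mx i i + delta_mx 0 i.
  pose Q : 'M[k]_n.+1 := delta_mx i 0 + delta_mx 0 0.
  have i0' : (0 == i) = false by rewrite eq_sym (negPf i0).
  have mulE := (mul_delta_mx_cond, eqxx, negPf i0, i0', mulr0n, mulr1n).
  have PP : P *m P = P by rewrite !(mulmxDl, mulmxDr) !mulE ?addr0 ?add0r.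
  have PQ : P *m Q = Q by rewrite !(mulmxDl, mulmxDr) !mulE ?addr0 ?add0r.
  have QP : Q *m P = P by rewrite !(mulmxDl, mulmxDr) !mulE ?addr0 ?add0r.
  have QQ : Q *m Q = Q by rewrite !(mulmxDl, mulmxDr) !mulE ?addr0 ?add0r.
  have /f0 : (P - Q) *m (P - Q) = 0.
    by rewrite mulmxBr !mulmxBl PP PQ QP QQ !subrr.
  rewrite raddfB /P /Q !raddfD /= (fE 0 i) ?i0' // (fE i 0) // addr0 oppr0 add0r.
  by move/eqP; rewrite subr_eq0 => /eqP.
rewrite {1}[A]matrix_sum_delta raddf_sum mulr_suml; apply: eq_bigr => i _.
rewrite raddf_sum (bigD1 i) //= big1 ?addr0 => [|j ji].
  by rewrite linearZ /= fD.
by rewrite linearZ /= fE 1?eq_sym // mulr0.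
Qed.

Definition gen_mx (k : closedFieldType) n : 'M[{mpoly k[n * n]}]_n :=
  \matrix_(i, j) 'X_(mxvec_index i j).

Lemma map_gen_mx (k : closedFieldType) n (a : 'rV[k]_(n * n)) :
  map_mx (meval (a 0)) (gen_mx k n) = vec_mx a.
Proof. by apply/matrixP => i j; rewrite !mxE mevalXU. Qed.

(** For p vanishing on SL, the differential at 1 kills square-zero matrices, so it is a multiple of
    the trace: matrices of trace 0 are tangent. Conversely [\det - 1] has a nonzero multiple of the
    trace as differential. Generators of the vanishing ideal never have to be found. *)
Lemma lie_algebra_SL (k : closedFieldType) (k_char0 : [pchar k] =i pred0) n
    (x : 'rV[k]_(n.+1 * n.+1)) :
  lie_algebra (SL k n.+1) x <-> \tr (vec_mx x) = 0.
Proof.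
pose o : 'rV[k]_(n.+1 * n.+1) := mxvec 1%:M.
pose T p (A : 'M[k]_n.+1) := directional o (mxvec A) p.
have lineT p A (r : {poly k}) : (forall t, r.[t] = p.@[(o + t *: mxvec A) 0]) ->
    T p A = r^`().[0].
  move=> rE; rewrite /T -deriv_line_poly; congr (_^`()).[_].
  apply/eqP; rewrite -subr_eq0; apply/eqP/horner_all_eq0 => t.
  by rewrite hornerD hornerN rE horner_line_poly subrr.
have Ttr p A : p \in vanishing (SL k n.+1) -> T p A = \tr A * T p (delta_mx 0 0).
  move=> /vanishingP pS.
  have Tlin : scalar (T p).
    by move=> c B C; rewrite /T linearP directional_linear.
  pose lT := GRing.isLinear.Build _ _ _ _ (T p) Tlin.
  pose f : {scalar 'M[k]_n.+1} := HB.pack (T p) lT.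
  apply: (@trace_form _ _ f) => B B2 /=.
  rewrite -[LHS]/(T p B) (lineT p B 0) ?deriv0 ?horner0 // => t.
  rewrite horner0 pS //= /SL_point -linearZ -linearD mxvecK.
  exact: det_add_square0.
split=> [xT|x0 p pS].
  pose p : {mpoly k[n.+1 * n.+1]} := \det (gen_mx k n.+1) - 1.
  have evp (a : 'rV[k]_(n.+1 * n.+1)) : p.@[a 0] = \det (vec_mx a) - 1.
    by rewrite mevalB meval1 -det_map_mx map_gen_mx.
  have pS : p \in vanishing (SL k n.+1).
    by apply/vanishingP => a aS; rewrite evp aS subrr.
  (* On the line (1 + t) times the identity, [p] is (1 + t)^(n+1) - 1. Its derivative at 0 is
     nonzero in characteristic 0, which makes the multiple of the trace nonzero. *)
  have T1 : T p 1%:M = n.+1%:R.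
    rewrite (lineT p _ (('X + 1) ^+ n.+1 - 1)) => [|t].
      rewrite derivB derivC subr0 deriv_exp derivD derivX derivC addr0 mul1r.
      by rewrite hornerMn !hornerE expr1n.
    rewrite evp /o -linearZ -linearD mxvecK scale_scalar_mx mulr1 -raddfD.
    by rewrite /= det_scalar !hornerE [1 + t]addrC.
  have n0 : n.+1%:R != 0 :> k by rewrite ((pcharf0P k).1 k_char0).
  have := xT p pS; rewrite -/(directional _ _ _) -[x]vec_mxK -/(T p _) Ttr //.
  move/eqP; rewrite mulf_eq0 vec_mxK => /orP[/eqP //|/eqP c0].
  by move: T1 n0; rewrite Ttr // c0 mulr0 => <-; rewrite eqxx.
rewrite -/(directional _ _ _) -[x]vec_mxK -/(T p _) Ttr //.
by rewrite x0 mul0r.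
Qed.

(** * The Cayley map *)

Section ComorphismValues.
Variables (k : closedFieldType) (N M : nat).
Variables (X : affine_variety k N) (Y : affine_variety k M).
Variables (phi : rational_map X Y).
Variable h : {rmorphism function_field Y -> function_field X}.
Hypothesis hphi : is_comorphism phi h.

Lemma comorphism_const c : h (poly_fun Y c%:MP) = poly_fun X c%:MP.
Proof. by rewrite hphi (mmapC _ (poly_fun X \o @mpolyC N k)). Qed.

Lemma comorphism_var i : h (poly_fun Y 'X_i) = phi 0 i.
Proof. by rewrite hphi (mmapX _ (poly_fun X \o @mpolyC N k)) mmap1U. Qed.

Lemma comorphism_value a b f v : X a -> map_value phi a b ->
  fun_value f b v -> fun_value (h f) a v.
Proof.
move=> Xa phiab [p [q [qb -> ->]]].
have hv P : fun_value (h (poly_fun Y P)) a P.@[b 0].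
  by rewrite hphi; apply: fun_value_subst.
by rewrite fmorph_div; apply: fun_valueM => //; apply: fun_valueV.
Qed.

End ComorphismValues.

Lemma map_value_mxvec (k : closedFieldType) N (X : affine_variety k N) m n
    (F : 'M[function_field X]_(m, n)) a (V : 'M[k]_(m, n)) :
  map_value (mxvec F) a (mxvec V) <-> mx_value a F V.
Proof.
split=> [FV i j|FV i].
  by have := FV (mxvec_index i j); rewrite !mxvecE.
by case/mxvec_indexP: i => i j; rewrite !mxvecE.
Qed.

Lemma mx_value_inj (k : closedFieldType) N (X : affine_variety k N) a m n
    (F : 'M[function_field X]_(m, n)) (V W : 'M[k]_(m, n)) :
  X a -> mx_value a F V -> mx_value a F W -> V = W.
Proof.
by move=> Xa FV FW; apply/matrixP => i j; apply: (fun_value_inj Xa (FV i j)).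
Qed.

Definition cayley_shift (F : fieldType) n (z c : F) (A : 'M[F]_n) :=
  cayley_mx z A - c%:M.

Lemma map_cayley_shift (F K : fieldType) (h : {rmorphism F -> K}) n z c
    (A : 'M[F]_n) :
  map_mx h (cayley_shift z c A) = cayley_shift (h z) (h c) (map_mx h A).
Proof.
rewrite /cayley_shift /cayley_mx /cayley_quot map_mxB map_scalar_mx map_mxZ.
rewrite fmorphV -trace_map_mx map_mxM map_invmx !map_mxB !map_scalar_mx.
by rewrite rmorph1.
Qed.

Lemma map_twist_poly (F K : fieldType) (h : {rmorphism F -> K}) n z
    (W : 'M[F]_n) :
  map_poly h (twist_poly W z) = twist_poly (map_mx h W) (h z).
Proof.
apply/polyP => i; rewrite coef_map !coef_poly; case: ifP => _ /=; last exact: rmorph0.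
by rewrite rmorphM rmorphB rmorph1 fmorphV rmorphXn -map_char_poly coef_map.
Qed.

Lemma cayley_mx_conj (F : fieldType) n z (P A : 'M[F]_n) :
    P \in unitmx -> A - z%:M \in unitmx ->
  cayley_mx z (P *m A *m invmx P) = P *m cayley_mx z A *m invmx P.
Proof.
move=> uP uB.
have conjB c : P *m A *m invmx P - c%:M = P *m (A - c%:M) *m invmx P.
  rewrite mulmxBr mulmxBl; congr (_ - _).
  by rewrite mul_mx_scalar -scalemxAl mulmxV // scalemx1.
have invE : invmx (P *m (A - z%:M) *m invmx P) = P *m invmx (A - z%:M) *m invmx P.
  have uC : P *m (A - z%:M) *m invmx P \in unitmx.
    by rewrite !unitmx_mul unitmx_inv uP uB.
  apply: (can_inj (mulKmx uC)); rewrite mulmxV //.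
  by rewrite !mulmxA mulmxKV // mulmxK // mulmxV.
have quotE : cayley_quot z (P *m A *m invmx P) = P *m cayley_quot z A *m invmx P.
  by rewrite /cayley_quot !conjB invE !mulmxA mulmxKV.
rewrite /cayley_mx quotE -scalemxAr -scalemxAl; congr (_^-1 *: _).
by rewrite mxtrace_mulC mulmxA mulVmx // mul1mx.
Qed.

Lemma cayley_shift_conj (F : fieldType) n z c (P A : 'M[F]_n) :
    P \in unitmx -> A - z%:M \in unitmx ->
  cayley_shift z c (P *m A *m invmx P) = P *m cayley_shift z c A *m invmx P.
Proof.
move=> uP uB; rewrite /cayley_shift cayley_mx_conj // mulmxBr mulmxBl.
by congr (_ - _); rewrite mul_mx_scalar -scalemxAl mulmxV // scalemx1.
Qed.

Lemma rpred_invmx (K : fieldType) (S : divringClosed K) n (A : 'M[K]_n) :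
  (forall i j, A i j \in S) -> forall i j, invmx A i j \in S.
Proof.
have detS m (B : 'M[K]_m) : (forall i j, B i j \in S) -> \det B \in S.
  move=> BS; apply: rpred_sum => s _; rewrite rpredM ?rpredX ?rpredN1 //.
  by apply: rpred_prod => i _.
move=> AS i j; rewrite /invmx; case: ifP => // _.
rewrite !mxE rpredM ?rpredV ?detS // rpredM ?rpredX ?rpredN1 // detS // => r s.
by rewrite !mxE.
Qed.

Lemma rpred_pencil (K : fieldType) (S : divringClosed K) n u c (W : 'M[K]_n) :
    u \in S -> c \in S -> (forall i j, W i j \in S) ->
  forall i j, (u%:M - c *: W) i j \in S.
Proof. by move=> uS cS WS i j; rewrite !mxE rpredB ?rpredM ?rpredMn. Qed.

Section CayleyMap.
Variables (k : closedFieldType) (k_char0 : [pchar k] =i pred0) (m : nat).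
Let n := m.+3.
Variable z : k.
Hypotheses (z1 : z != 1) (zn : z ^+ n = 1).

Let G := SL k n.
Let K := function_field G.
Let const (c : k) : K := poly_fun G c%:MP.

Let n0 : n%:R != 0 :> k.
Proof. by rewrite ((pcharf0P k).1 k_char0). Qed.

Let z0 : z != 0.
Proof. by apply: contra_eq_neq zn => ->; rewrite expr0n eq_sym oner_eq0. Qed.

Let const_inj a b : const a = const b -> a = b.
Proof.
move=> e; apply: (fun_value_inj (SL_one k n) (fun_value_const _ _ a)).
by rewrite -/(const a) e; apply: fun_value_const.
Qed.

Definition shift_mx : 'M[{mpoly k[n * n]}]_n := gen_mx k n + (n%:R^-1)%:MP%:M.

(* Its nonvanishing at W - 1/n excludes the root u = 0 of the twist polynomial
   (first factor) and a pair of eigenvalues u, u/z of W (second factor), so that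
   every root u of the twist polynomial yields a preimage. *)
Definition good_poly : {mpoly k[n * n]} :=
  (char_poly shift_mx)`_1 *
  \det (horner_mx ((z^-1)%:MP *: shift_mx) (char_poly shift_mx)).

Lemma good_polyE (b : 'rV[k]_(n * n)) (W := vec_mx b + (n%:R^-1)%:M) :
  good_poly.@[b 0] =
    (char_poly W)`_1 * \det (horner_mx (z^-1 *: W) (char_poly W)).
Proof.
have WE : map_mx (meval (b 0)) shift_mx = W.
  by rewrite map_mxD map_gen_mx map_scalar_mx /= mevalC.
by rewrite mevalM -det_map_mx map_horner_mx map_mxZ /= mevalC map_char_poly WE
   -WE -map_char_poly coef_map.
Qed.

(** At W = 1/n the characteristic polynomial is (x - 1/n)^n, so both factors are explicit. As 0 lies
    in sl_n, the good locus is dense there. *)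
Lemma good_poly0 : good_poly.@[(0 : 'rV[k]_(n * n)) 0] != 0.
Proof.
rewrite good_polyE linear0 add0r; set a := n%:R^-1.
have a0 : a != 0 by rewrite invr_eq0.
have chE : char_poly (a%:M : 'M[k]_n) = ('X - a%:P) ^+ n.
  rewrite /char_poly -det_scalar; congr (\det _).
  by rewrite /char_poly_mx map_scalar_mx raddfB.
rewrite chE scale_scalar_mx mulf_neq0 //.
  have := coef_deriv (('X - a%:P) ^+ n) 0; rewrite mulr1n => <-.
  rewrite deriv_exp derivB derivX derivC subr0 mul1r -horner_coef0 hornerMn.
  rewrite horner_exp hornerXsubC sub0r -mulr_natr mulf_neq0 //.
  by rewrite expf_neq0 // oppr_eq0.
have -> : horner_mx (z^-1 * a)%:M (('X - a%:P) ^+ n) = ((z^-1 * a - a) ^+ n)%:M :> 'M[k]_n.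
  rewrite rmorphXn rmorphB /= horner_mx_X horner_mx_C -raddfB /=.
  by rewrite rmorphXn.
rewrite det_scalar !expf_neq0 // -[X in _ - X]mul1r -mulrBl mulf_neq0 //.
by rewrite subr_eq0; apply: contra_neq z1 => /(congr1 GRing.inv); rewrite invrK invr1.
Qed.

Let X : 'M[K]_n := map_mx (poly_fun G) (gen_mx k n).
Let W : 'M[K]_n := cayley_mx (const z) X.
Let Y : 'M[K]_n := cayley_shift (const z) (const n%:R^-1) X.
Definition cayley_coord : 'rV[K]_(n * n) := mxvec Y.

Lemma mx_value_gen a : mx_value a X (vec_mx a).
Proof. by move=> i j; rewrite !mxE -[a 0 _]mevalXU; apply: fun_value_poly. Qed.

Lemma mx_value_const a l (P : 'M[k]_l) : mx_value a (map_mx const P) P.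
Proof. by move=> i j; rewrite mxE; apply: fun_value_const. Qed.

Lemma mx_value_sub a : G a -> mx_value a (X - (const z)%:M) (vec_mx a - z%:M).
Proof.
move=> Ga; apply: mx_valueD => //; first exact: mx_value_gen.
by apply/mx_valueN/mx_value_scalar/fun_value_const.
Qed.

Lemma mx_value_quot a : G a -> vec_mx a - z%:M \in unitmx ->
  mx_value a (cayley_quot (const z) X) (cayley_quot z (vec_mx a)).
Proof.
move=> Ga uA; apply: mx_valueM => //.
  apply: mx_valueD => //; first exact: mx_value_gen.
  by apply/mx_valueN/mx_value_scalar/fun_value1.
by apply: mx_value_inv => //; apply: mx_value_sub.
Qed.

Lemma cayley_coord_value a : G a -> vec_mx a - z%:M \in unitmx ->
    \tr (cayley_quot z (vec_mx a)) != 0 ->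
  map_value cayley_coord a (mxvec (cayley_mx z (vec_mx a) - (n%:R^-1)%:M)).
Proof.
move=> Ga uA t0; apply/map_value_mxvec; apply: mx_valueD => //; last first.
  by apply/mx_valueN/mx_value_scalar/fun_value_const.
have Vv := mx_value_quot Ga uA; apply: mx_valueZ => //.
by apply: fun_valueV => //; apply: fun_value_trace.
Qed.

Lemma cayley_coord_onto (b : 'rV[k]_(n * n)) :
    \tr (vec_mx b) = 0 -> good_poly.@[b 0] != 0 ->
  exists a, [/\ G a, vec_mx a - z%:M \in unitmx,
    \tr (cayley_quot z (vec_mx a)) != 0 & map_value cayley_coord a b].
Proof.
move=> trb; rewrite good_polyE; set V := _ + _; rewrite mulf_eq0 negb_or.
case/andP=> c1 dV.
have trV : \tr V = 1 by rewrite linearD /= trb add0r mxtrace_scalar -(mulr_natr n%:R^-1) mulVf.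
have [u [u0 qu uV]] := twist_poly_root z1 zn trV c1 dV.
have [A [dA uA tA AV]] := cayley_mx_inv z1 z0 u0 zn isT trV qu uV.
have GA : G (mxvec A) by rewrite /= /SL_point mxvecK.
exists (mxvec A); rewrite mxvecK; split=> //.
have := cayley_coord_value GA; rewrite mxvecK => /(_ uA tA).
by rewrite AV addrK vec_mxK.
Qed.

(** A rational function with a nonzero value at one point is nonzero; the point is a preimage of 0,
    which is good by [good_poly0]. *)
Let X_unit_trace :
  X - (const z)%:M \in unitmx /\ \tr (cayley_quot (const z) X) != 0.
Proof.
have [|a [Ga uA tA _]] := cayley_coord_onto _ good_poly0.
  by rewrite linear0 mxtrace0.
split.
  rewrite unitmxE unitfE; rewrite unitmxE unitfE in uA.
  by apply: (fun_value_neq0 Ga uA); apply: fun_value_det => //; apply: mx_value_sub.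
by apply: (fun_value_neq0 Ga tA); apply: fun_value_trace => //; apply: mx_value_quot.
Qed.

Let constz1 : const z != 1.
Proof.
apply: contra_neq z1 => e; apply: const_inj; rewrite e.
by rewrite /const !rmorph1.
Qed.

Let constz0 : const z != 0.
Proof.
apply: contra_neq z0 => e; apply: const_inj; rewrite e.
by rewrite /const !rmorph0.
Qed.

Let constzn : const z ^+ n = 1.
Proof. by rewrite /const -!rmorphXn /= zn !rmorph1. Qed.

Let detX : \det X = 1.
Proof.
rewrite det_map_mx; apply/eqP; rewrite -subr_eq0 -(rmorph1 (poly_fun G)).
rewrite -rmorphB poly_fun_eq0; apply/vanishingP => a Ga.
by rewrite mevalB meval1 -det_map_mx map_gen_mx Ga subrr.
Qed.

Let trW : \tr W = 1.
Proof.
have [uX tX] := X_unit_trace.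
by have [] := cayley_mxK constz1 uX tX.
Qed.

Let trF : \tr Y = 0.
Proof.
have constn : const n%:R = n%:R.
  exact: (rmorph_nat (poly_fun G \o @mpolyC _ _) n).
rewrite /Y /cayley_shift linearB /= trW mxtrace_scalar -(mulr_natr (const _)) -constn.
by rewrite /const -rmorphM -mpolyCM mulVf // !rmorph1 subrr.
Qed.

(** The point [a] may lie outside the domain of the explicit formula; the identity tr Y = 0 over
    k(SL_n) still applies to every value of the map. *)
Lemma cayley_into a b : G a -> map_value cayley_coord a b -> lie_algebra G b.
Proof.
move=> Ga; rewrite -[b]vec_mxK => /map_value_mxvec Fb.
apply/lie_algebra_SL => //; rewrite mxvecK.
have := fun_value_trace Ga Fb; rewrite trF => trb.
by apply: (fun_value_inj Ga trb); apply: fun_value0.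
Qed.

Definition cayley_map : rational_map G (lie_algebra G) := RationalMap cayley_into.

Lemma cayley_dominant : dominant cayley_map.
Proof.
move=> Z [S ZS] ZP b lieb; apply/ZS => p Sp.
have lie0 : lie_algebra G (0 : 'rV_(n * n)).
  by apply/lie_algebra_SL => //; rewrite linear0 mxtrace0.
have q0 := notin_vanishing lie0 good_poly0.
suff /vanishingP/(_ b lieb) : p \in vanishing (lie_algebra G) by [].
apply: (vanishing_dense q0) => c liec qc.
have /lie_algebra_SL trc := liec.
have [a [Ga _ _ ac]] := cayley_coord_onto (trc k_char0) qc.
by have /ZS/(_ p Sp) := ZP a c Ga ac.
Qed.

(** * Equivariance under conjugation *)

Section Conjugation.
Variable g : 'M[k]_n.
Hypothesis Gg : G (mxvec g).

Let ug : g \in unitmx := SL_unit Gg.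
Let gK : 'M[K]_n := map_mx const g.
Let conj_coord : 'rV[K]_(n * n) := mxvec (gK *m X *m invmx gK).

Let invgK : invmx gK = map_mx const (invmx g).
Proof. by rewrite (map_invmx (poly_fun G \o @mpolyC _ _)). Qed.

Let conj_value a : G a ->
  map_value conj_coord a (mxvec (g *m vec_mx a *m invmx g)).
Proof.
move=> Ga; apply/map_value_mxvec; rewrite invgK.
apply: (mx_valueM Ga); last exact: mx_value_const.
by apply: (mx_valueM Ga); [apply: mx_value_const | apply: mx_value_gen].
Qed.

Let conj_into a b : G a -> map_value conj_coord a b -> G b.
Proof.
move=> Ga; have := conj_value Ga; rewrite -[b]vec_mxK.
move=> /map_value_mxvec cv /map_value_mxvec cb.
rewrite -(mx_value_inj Ga cv cb); apply: cg_mul (cg_inv Gg).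
by apply: cg_mul => //; rewrite vec_mxK.
Qed.

Let conj_map : rational_map G G := RationalMap conj_into.

Let conj_dominant : dominant conj_map.
Proof.
move=> Z _ ZP b Gb; rewrite -[b]vec_mxK.
have Ga : G (mxvec (invmx g *m vec_mx b *m g)).
  apply: cg_mul => //; apply: cg_mul; [exact: cg_inv | by rewrite vec_mxK].
have := ZP _ _ Ga (conj_value Ga).
by rewrite mxvecK !mulmxA mulmxV // mul1mx mulmxK.
Qed.

(* The automorphism s of k(SL_n) induced by conjugation by g turns equivariance
   into the identity s Y = g Y g^-1 of matrices over k(SL_n). *)
Lemma cayley_equivariant_at x y w : G (mxvec x) ->
    map_value cayley_coord (mxvec x) (mxvec y) ->
    map_value cayley_coord (mxvec (g *m x *m invmx g)) (mxvec w) ->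
  w = g *m y *m invmx g.
Proof.
move=> Gx /map_value_mxvec xy /map_value_mxvec xw.
have [s sE] := dominant_comorphism conj_dominant.
have sc c : s (const c) = const c by apply: comorphism_const sE _.
have sX : map_mx s X = gK *m X *m invmx gK.
  apply/matrixP => i j; rewrite ![map_mx _ _ i j]mxE mxE (comorphism_var sE) /=.
  by rewrite mxvecE.
have [uX _] := X_unit_trace.
have ugK : gK \in unitmx by rewrite (map_unitmx (poly_fun G \o @mpolyC _ _)).
have sY : map_mx s Y = gK *m Y *m invmx gK.
  apply: etrans (map_cayley_shift _ _ _ _) _.
  by rewrite (sc z) (sc n%:R^-1) sX (cayley_shift_conj _ ugK uX).
have xw' : map_value conj_coord (mxvec x) (mxvec (g *m x *m invmx g)).
  by have := conj_value Gx; rewrite mxvecK.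
(* The value of s Y at x is the value of Y at g x g^-1, that is w; computed from g Y g^-1 it is g y
   g^-1. *)
have swv : mx_value (mxvec x) (map_mx s Y) w.
  by move=> i j; rewrite mxE; apply: (comorphism_value sE Gx xw').
apply: (mx_value_inj Gx swv); rewrite sY invgK.
apply: (mx_valueM Gx); last exact: mx_value_const.
by apply: (mx_valueM Gx); [apply: mx_value_const | apply: xy].
Qed.

End Conjugation.

Lemma cayley_map_generalized : generalized_Cayley_map cayley_map.
Proof.
split; first exact: cayley_dominant.
by move=> g x Gg Gx y w; apply: cayley_equivariant_at.
Qed.

Lemma cayley_map_degree : exists2 d, (d <= n - 2)%N & degree cayley_map d.
Proof.
have [h hE] := dominant_comorphism cayley_dominant.
set L := function_field (lie_algebra G).
pose lconst c : L := poly_fun (lie_algebra G) c%:MP.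
have hc c : h (lconst c) = const c by apply: comorphism_const hE _.
(* The generic matrix of sl_n with the shift by 1/n undone: its image under the comorphism is [W],
   so the polynomial killing u comes from k(sl_n). *)
pose W0 : 'M[L]_n :=
  map_mx (poly_fun (lie_algebra G)) (gen_mx k n) + (lconst n%:R^-1)%:M.
have hW0 : map_mx h W0 = W.
  have hgen : map_mx h (map_mx (poly_fun (lie_algebra G)) (gen_mx k n)) = Y.
    apply/matrixP => i j; rewrite 3![in LHS]mxE.
    by apply: etrans (comorphism_var hE _) _; apply: mxvecE.
  by rewrite map_mxD hgen map_scalar_mx /= hc subrK.
have [uX tX] := X_unit_trace.
have [u [qu XE]] := cayley_mx_root constz1 constz0 constzn isT detX uX tX.
have lconst_inj : injective lconst.
  by move=> a b e; apply: const_inj; rewrite -!hc e.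
have lz1 : lconst z != 1.
  by apply: contra_neq constz1 => e; rewrite -hc e rmorph1.
have lzn : lconst z ^+ n = 1.
  by apply: (fmorph_inj h); rewrite rmorphXn hc constzn rmorph1.
have trW0 : \tr W0 = 1.
  by apply: (fmorph_inj h); rewrite -trace_map_mx hW0 trW rmorph1.
have [|||d dp deg] := @generator_degree L K h u (twist_poly W0 (lconst z)).
- by apply: contraNneq (twist_poly_neq0 lz1 lzn trW0) => ->; rewrite coef0.
- by rewrite map_twist_poly hW0 hc.
(* A field containing u and the image of k(sl_n) contains the entries of W, hence those of X = (u -
   W)^-1 (u - zW), which are the coordinate functions of SL_n. *)
- move=> S hS uS.
  have cS c : const c \in S by rewrite -hc.
  have WS i j : W i j \in S by rewrite -hW0 mxE.
  have sS c i j : (c \in S) -> (u%:M - c *: W) i j \in S.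
    by move=> cS'; apply: rpred_pencil.
  have XS i j : X i j \in S.
    rewrite XE mxE; apply: rpred_sum => l _; rewrite rpredM ?sS //.
    by apply: rpred_invmx => i' j'; rewrite -[cayley_mx _ _]scale1r; apply: sS (rpred1 _).
  have pS p : poly_fun G p \in S.
    elim/mpolyind: p => [|c e p _ _ IH]; first by rewrite rmorph0 rpred0.
    rewrite rmorphD -mul_mpolyC rmorphM rpredD ?rpredM ?cS //.
    rewrite mpolyXE_id rmorph_prod; apply: rpred_prod => i _.
    rewrite rmorphXn rpredX //; case/mxvec_indexP: i => i j.
    by have := XS i j; rewrite !mxE.
  by move=> f; have [p [q [_ ->]]] := function_fieldP f; rewrite rpred_div.
exists d; last by exists h.
(* The twist polynomial has size at most n - 1 and [d] is strictly below its size. *)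
by rewrite -ltnS (leq_trans dp) // (leq_trans (size_poly _ _)).
Qed.
End CayleyMap.

(** Take a root of 1 + x + ... + x^(n-1): its value at 1 is n, nonzero in characteristic 0. *)
Lemma exists_nontrivial_root_of_unity (k : closedFieldType)
    (k_char0 : [pchar k] =i pred0) n : (1 < n)%N ->
  exists2 z : k, z != 1 & z ^+ n = 1.
Proof.
move=> n1; pose p : {poly k} := \poly_(i < n) 1.
have sp : size p = n by apply: size_poly_eq; apply: oner_neq0.
have /closed_rootP[z /rootP pz] : size p != 1%N by rewrite sp gtn_eqF.
have pE x : p.[x] = \sum_(i < n) x ^+ i.
  by rewrite horner_poly; apply: eq_bigr => i _; rewrite mul1r.
exists z; last by apply/eqP; rewrite -subr_eq0 subrX1 -pE pz mulr0.
apply/eqP => z1; move: pz; rewrite pE z1 (eq_bigr (fun=> 1)) => [|i _].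
  rewrite sumr_const card_ord => /eqP; rewrite ((pcharf0P k).1 k_char0).
  by case: n n1 {p sp pE}.
by rewrite expr1n.
Qed.

Lemma Cayley_degree_exists (k : closedFieldType) n (G : connected_group k n)
    (phi : rational_map G (lie_algebra G)) d :
    generalized_Cayley_map phi -> degree phi d ->
  exists2 e, Cayley_degree G e & (e <= d)%N.
Proof.
move=> gphi phid; pose P e :=
  `[< exists2 psi : rational_map G (lie_algebra G),
       generalized_Cayley_map psi & degree psi e >].
have exP : exists e, P e by exists d; apply/asboolP; exists phi.
case: (ex_minnP exP) => e /asboolP[psi gpsi psie] emin.
exists e; last by apply: emin; apply/asboolP; exists phi.
split; first by exists psi.
by move=> psi' e' gpsi' psie'; apply: emin; apply/asboolP; exists psi'.
Qed.

Theorem theorem2 (k : closedFieldType) (k_char0 : [pchar k] =i pred0)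
    (n : nat) (n_ge3 : (3 <= n)%N) :
  exists2 d : nat, Cayley_degree (SL k n) d & (d <= n - 2)%N.
Proof.
case: n n_ge3 => [|[|[|m]]] // _.
have [z z1 zn] := exists_nontrivial_root_of_unity k_char0 (isT : 1 < m.+3)%N.
have [d dn deg] := cayley_map_degree k_char0 z1 zn.
have [e Ge ed] := Cayley_degree_exists (cayley_map_generalized k_char0 z1 zn) deg.
by exists e; [|apply: leq_trans dn].
Qed.
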